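(* Suppose that $C=(C_\bullet,d,s,t)$ is an $H$-unital para-precyclic $k$-module and $k\supset\mathbb Q$. Then $$\bar\pi^\natural\bar\nu^\natural=1,\qquad \bar\nu^\natural\bar\pi^\natural=1+(b+Bu^{-1})\bar\varphi^\natural+\bar\varphi^\natural(b+Bu^{-1}),\qquad \bar\pi^\natural\bar\varphi^\natural=0 .$$ In particular, we obtain a deformation retract of $C_T^\natural$ to $C^\lambda$.
   Context: $k$ is a unital ring, not assumed commutative; $k$-modules are left modules. A para-precyclic $k$-module consists of $k$-modules $C_m$, $m\ge0$, face maps $d_j:C_m\to C_{m-1}$ ($0\le j\le m$) with $d_id_j=d_{j-1}d_i$ for $i<j$, and an invertible $k$-linear map $t:C_\bullet\to C_\bullet$ of degree $0$ with $td_i=d_{i+1}t$ for $0\le i\le m-1$ and $d_m=d_0t$ on $C_m$ (notation: $d=d_m$ on $C_m$). Put $T=t^{m+1}$ on $C_m$; it commutes with $d$ and $t$. Let $b=\sum_{j=0}^m(-1)^jd_j$, $b'=\sum_{j=0}^{m-1}(-1)^jd_j$, $\tau=(-1)^mt$, $N=1+\tau+\cdots+\tau^m$ on $C_m$. It is $H$-unital, written $(C_\bullet,d,s,t)$, when equipped with a $k$-linear map $s:C_\bullet\to C_{\bullet+1}$ commuting with $T$ with $b's+sb'=1$. Put $s'=sb's$ and $B=(1-\tau)s'N:C_\bullet\to C_{\bullet+1}$. Then $(C_\bullet,b,B)$ satisfies $b^2=B^2=0$, $bB+Bb=1-T$. Let $C_{T,\bullet}=C_\bullet/\operatorname{ran}(1-T)$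 with canonical projection $\pi_T$; all the structure descends to it. $C^\natural_m=\bigoplus_{2p\le m}C_{m-2p}u^p$ and $C^{\natural\natural}_m=\bigoplus_{p+q=m}C_qu^p$ ($u$ a formal variable; $u^{-1}(xu^p)=xu^{p-1}$ for $p\ge1$, $u^{-1}(xu^0)=0$; operators on $C_\bullet$ act on coefficients). On $C^\natural_\bullet$ we use the operator $b+Bu^{-1}$; $C_T^\natural=(C_{T,\bullet}^\natural,b+Bu^{-1})$ is the same construction for $C_T$ and is a chain complex. On $C^{\natural\natural}_\bullet$ put $\delta(xu^{2p})=bxu^{2p}$, $\delta(xu^{2p+1})=-b'xu^{2p+1}$. $C^\lambda=(C^\lambda_\bullet,b)$, $C^\lambda_m=C_m/\operatorname{ran}(1-\tau)$, with $b$ induced by $b$; $\pi^\lambda:C_\bullet\to C^\lambda_\bullet$ is the canonical projection. $\pi^\natural:C^\natural_\bullet\to C^\lambda_\bullet$ is $\pi^\natural(xu^0)=\pi^\lambda(x)$, $\pi^\natural(xu^p)=0$ for $p\ge1$. Define $I:C^\natural_\bullet\to C^{\natural\natural}_\bullet$ by $I(xu^0)=xu^0$, $I(xu^p)=xu^{2p}+s'Nxu^{2p-1}$ ($p\ge1$), and $J:C^{\natural\natural}_\bullet\to C^\natural_\bullet$ by $J(xu^{2p})=xu^p$, $J(xu^{2p+1})=(1-\tau)s'xu^p$. For $x\in C_m$ put $\hat x=(m+1)^{-1}x$, $\hat Nx=N\hat x$, $\hat Dx=\sum_{j=0}^m(m-j)\tau^j\hat x$. Define $\nu(x)=\hat Nx\,u^0\in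 C^{\natural\natural}$; $\varphi(xu^{2p})=-\hat Dx\,u^{2p+1}$, $\varphi(xu^{2p+1})=-\hat x\,u^{2p+2}$ on $C^{\natural\natural}_\bullet$; $\varphi^{\natural\natural}=\sum_{j\ge0}(\varphi\delta)^j\varphi$; $\nu_0^{\natural\natural}=\sum_{j\ge0}(\varphi\delta)^j\nu:C_\bullet\to C^{\natural\natural}_\bullet$. Put $\nu_0^\natural=J\nu_0^{\natural\natural}:C_\bullet\to C^\natural_\bullet$ and $\varphi^\natural=J\varphi^{\natural\natural}I:C^\natural_\bullet\to C^\natural_{\bullet+1}$. These descend: $\bar\pi^\natural:C_{T,\bullet}^\natural\to C^\lambda_\bullet$ with $\bar\pi^\natural\pi_T=\pi^\natural$; $\bar\nu^\natural:C^\lambda_\bullet\to C_{T,\bullet}^\natural$ with $\bar\nu^\natural\pi^\lambda=\pi_T\nu_0^\natural$; $\bar\varphi^\natural:C_{T,\bullet}^\natural\to C_{T,\bullet+1}^\natural$ with $\bar\varphi^\natural\pi_T=\pi_T\varphi^\natural$. The maps $\bar\pi^\natural$ and $\bar\nu^\natural$ are chain maps. A deformation retract means chain maps $f,g$ with $fg=1$ and $gf$ chain homotopic to $1$. *)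

(* Defs.v *)
From HB Require Import structures.
From mathcomp Require Import all_boot all_order all_algebra.
From mathcomp Require Import boolp.

Set Implicit Arguments.
Unset Strict Implicit.
Unset Printing Implicit Defensive.

Import GRing.Theory.
Local Open Scope ring_scope.
Local Open Scope quotient_scope.

Section Cokernel.
Variables (k : nzRingType) (U V : lmodType k) (f : {linear U -> V}).

Definition lrange : {pred V} := fun v => `[< exists u, f u = v >].

Lemma lrangeP v : reflect (exists u, f u = v) (v \in lrange).
Proof. exact: asboolP. Qed.

Lemma lrange_zmod_closed : zmod_closed lrange.
Proof.
split; first by apply/lrangeP; exists 0; rewrite linear0.
move=> _ _ /lrangeP[u <-] /lrangeP[v <-]; apply/lrangeP.
by exists (u - v); rewrite linearB.
Qed.

HB.instance Definition _ := GRing.isZmodClosed.Build V lrange lrange_zmod_closed.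

Definition coker : Type := Quotient.quot lrange.
HB.instance Definition _ := GRing.Zmodule.on coker.

Definition cpi (v : V) : coker := \pi_(Quotient.quot lrange) v.

Lemma cpi_eq u v : cpi u = cpi v <-> exists w, f w = u - v.
Proof.
rewrite /cpi; split=> [/eqP|].
  by rewrite -Quotient.idealrBE => /lrangeP.
by move=> uv; apply/eqP; rewrite -Quotient.idealrBE; apply/lrangeP.
Qed.

Lemma cpi_surj q : exists v, cpi v = q.
Proof. by exists (repr q); exact: reprK. Qed.

Lemma cpi_is_zmod_morphism : zmod_morphism cpi.
Proof. exact: (raddfB \pi_(Quotient.quot lrange)). Qed.

HB.instance Definition _ := GRing.isZmodMorphism.Build V coker cpi cpi_is_zmod_morphism.

Definition coker_scale (a : k) (q : coker) : coker :=
  cpi (a *: (repr (q : Quotient.quot lrange))).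

Lemma coker_scaleE a v : coker_scale a (cpi v) = cpi (a *: v).
Proof.
apply/cpi_eq; have /cpi_eq[w fw] : cpi (repr (cpi v : Quotient.quot lrange)) = cpi v.
  exact: reprK.
by exists (a *: w); rewrite linearZ /= fw scalerBr.
Qed.

Fact coker_scaleA a b q : coker_scale a (coker_scale b q) = coker_scale (a * b) q.
Proof. by have [v <-] := cpi_surj q; rewrite !coker_scaleE scalerA. Qed.
Fact coker_scale1 : left_id 1 coker_scale.
Proof. by move=> q; have [v <-] := cpi_surj q; rewrite coker_scaleE scale1r. Qed.
Fact coker_scaleDr : right_distributive coker_scale +%R.
Proof.
move=> a q r; have [v <-] := cpi_surj q; have [w <-] := cpi_surj r.
by rewrite -raddfD !coker_scaleE scalerDr raddfD.
Qed.
Fact coker_scaleDl q : {morph coker_scale^~ q : a b / a + b}.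
Proof.
by move=> a b; have [v <-] := cpi_surj q; rewrite !coker_scaleE scalerDl raddfD.
Qed.

HB.instance Definition _ := GRing.Zmodule_isLmodule.Build k coker
  coker_scaleA coker_scale1 coker_scaleDr coker_scaleDl.

Fact cpi_is_scalable : scalable cpi.
Proof. by move=> a v; rewrite -coker_scaleE. Qed.

HB.instance Definition _ := GRing.isScalable.Build k V coker *:%R cpi cpi_is_scalable.

Lemma cpi_eq0 v : cpi v = 0 <-> exists u, f u = v.
Proof. by rewrite -(raddf0 cpi) cpi_eq subr0. Qed.

End Cokernel.

Section Descend.
Variables (k : nzRingType) (U V W : lmodType k).
Variables (p : {linear U -> V}) (f : {linear U -> W}).
Hypothesis p_surj : forall v, exists u, p u = v.

(* The map induced by [f] on the target [V] of the surjection [p]. *)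
Definition descend of (forall u, p u = 0 -> f u = 0) : V -> W :=
  fun v => f (projT1 (cid (p_surj v))).

Lemma descendE (pf : forall u, p u = 0 -> f u = 0) u : descend pf (p u) = f u.
Proof.
rewrite /descend; case: cid => u' /= pu'.
by apply/eqP; rewrite -subr_eq0 -linearB; apply/eqP/pf; rewrite linearB /= pu' subrr.
Qed.

Fact descend_is_linear pf : linear (descend pf).
Proof.
move=> a v w; have [x <-] := p_surj v; have [y <-] := p_surj w.
by rewrite -linearP !descendE linearP.
Qed.

HB.instance Definition _ pf :=
  GRing.isLinear.Build k V W *:%R (descend pf) (descend_is_linear pf).

End Descend.

Section OneMinus.
Variables (k : nzRingType) (V : lmodType k) (f : {linear V -> V}).

Definition one_minus (x : V) : V := x - f x.

Fact one_minus_is_linear : linear one_minus.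
Proof. by move=> a x y; rewrite /one_minus linearP scalerBr opprD addrACA. Qed.

HB.instance Definition _ :=
  GRing.isLinear.Build k V V *:%R one_minus one_minus_is_linear.

Fact iter_is_linear n : linear (iter n f).
Proof. by move=> a x y; elim: n => //= n ->; rewrite linearP. Qed.

End OneMinus.

(* The composite [g \o d] in degree [m], where [d] lowers the degree and is 0  *)
(* in degree 0.                                                                *)
Definition lowered (k : nzRingType) (A B W : nat -> lmodType k)
    (d : forall m, A m.+1 -> B m) (g : forall m, B m -> W m.+1) (m : nat) :
    A m -> W m :=
  match m with 0 => fun=> 0 | m'.+1 => fun x => g m' (d m' x) end.

Lemma linear_at0 (k : nzRingType) (U V : lmodType k) (f : U -> V) :
  linear f -> f 0 = 0.
Proof. by move=> /(_ (-1) 0 0); rewrite !scaler0 addr0 scaleN1r addNr. Qed.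

Lemma lowered_linear (k : nzRingType) (A B W : nat -> lmodType k)
    (d : forall m, A m.+1 -> B m) (g : forall m, B m -> W m.+1) m :
  (forall m, linear (d m)) -> (forall m, linear (g m)) -> linear (lowered d g (m := m)).
Proof.
move=> dl gl; case: m => [|m] a x y /=; first by rewrite scaler0 addr0.
by rewrite dl gl.
Qed.

Fact gtrunc_key : unit. Proof. exact: tt. Qed.

(* [gsum C m P] is the direct sum of the C_q u^r over q + |u| r = m, a         *)
(* homogeneous element being indexed by the degree q of its coefficient, which *)
(* determines the exponent of u; P selects the admissible values of m - q.     *)
(* Thus C^natural_m has |u| = 2 and P = even, with exponent (m - q) / 2, and   *)
(* C^naturalnatural_m has |u| = 1 and no condition, with exponent m - q.       *)
Section GradedSum.
Variables (k : nzRingType) (C : nat -> lmodType k) (m : nat) (P : pred nat).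

Definition gindex : pred nat := fun q => (q <= m)%N && P (m - q)%N.

Record gsum := GSum {
  coef :> forall q, C q;
  _ : forall q, ~~ gindex q -> coef q = 0 }.

Lemma coef0 (x : gsum) q : ~~ gindex q -> x q = 0.
Proof. by case: x q. Qed.

Lemma gsumP (x y : gsum) : (forall q, gindex q -> x q = y q) -> x = y.
Proof.
case: x y => x hx [y hy] /= xy; have e : x = y.
  apply: functional_extensionality_dep => q.
  by have [/xy //|nq] := boolP (gindex q); rewrite hx // hy.
by rewrite e in hx *; congr GSum; apply: Prop_irrelevance.
Qed.

Fact gtrunc_subproof (f : forall q, C q) q :
  ~~ gindex q -> (if gindex q then f q else 0) = 0.
Proof. by move/negbTE ->. Qed.

(* Locked, so that simplification does not expand coefficients. *)
Definition gtrunc (f : forall q, C q) : gsum :=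
  locked_with gtrunc_key (GSum (gtrunc_subproof f)).

Lemma gtruncE f q : gtrunc f q = if gindex q then f q else 0.
Proof. by rewrite /gtrunc unlock. Qed.

HB.instance Definition _ := gen_eqMixin gsum.
HB.instance Definition _ := gen_choiceMixin gsum.

Let gadd (x y : gsum) := gtrunc (fun q => x q + y q).
Let gopp (x : gsum) := gtrunc (fun q => - x q).
Let gscale (a : k) (x : gsum) := gtrunc (fun q => a *: x q).

Fact gaddA : associative gadd.
Proof. by move=> x y z; apply: gsumP => q Pq; rewrite !gtruncE Pq addrA. Qed.
Fact gaddC : commutative gadd.
Proof. by move=> x y; apply: gsumP => q Pq; rewrite !gtruncE Pq addrC. Qed.
Fact gadd0 : left_id (gtrunc (fun=> 0)) gadd.
Proof. by move=> x; apply: gsumP => q Pq; rewrite !gtruncE Pq add0r. Qed.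
Fact gaddN : left_inverse (gtrunc (fun=> 0)) gopp gadd.
Proof. by move=> x; apply: gsumP => q Pq; rewrite !gtruncE Pq addNr. Qed.

HB.instance Definition _ := GRing.isZmodule.Build gsum gaddA gaddC gadd0 gaddN.

Fact gscaleA a b x : gscale a (gscale b x) = gscale (a * b) x.
Proof. by apply: gsumP => q Pq; rewrite !gtruncE Pq scalerA. Qed.
Fact gscale1 : left_id 1 gscale.
Proof. by move=> x; apply: gsumP => q Pq; rewrite !gtruncE Pq scale1r. Qed.
Fact gscaleDr : right_distributive gscale +%R.
Proof. by move=> a x y; apply: gsumP => q Pq; rewrite !gtruncE Pq scalerDr. Qed.
Fact gscaleDl x : {morph gscale^~ x : a b / a + b}.
Proof. by move=> a b; apply: gsumP => q Pq; rewrite !gtruncE Pq scalerDl. Qed.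

HB.instance Definition _ := GRing.Zmodule_isLmodule.Build k gsum
  gscaleA gscale1 gscaleDr gscaleDl.

Lemma coefP a (x y : gsum) q : (a *: x + y) q = a *: x q + y q.
Proof.
have [Pq|nq] := boolP (gindex q); first by rewrite !gtruncE Pq.
by rewrite (coef0 (_ + _) nq) (coef0 x nq) (coef0 y nq) scaler0 addr0.
Qed.

Definition coef_at q (x : gsum) : C q := x q.
Fact coef_at_is_linear q : linear (coef_at q).
Proof. by move=> a x y; exact: coefP. Qed.
HB.instance Definition _ q :=
  GRing.isLinear.Build k gsum (C q) *:%R (coef_at q) (coef_at_is_linear q).

(* The homogeneous element with coefficient [y]; by convention it is 0 if      *)
(* [gsum C m P] has no summand C_q.                                            *)
Definition umon q (y : C q) : gsum :=
  gtrunc (fun q' => if @eqP _ q q' is ReflectT e then eq_rect q C y q' e else 0).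

Lemma umon_coef q (y : C q) : gindex q -> umon y q = y.
Proof.
by move=> Pq; rewrite gtruncE Pq; case: eqP => // e; rewrite (eq_irrelevance e erefl).
Qed.

Lemma umon_coef_neq q (y : C q) q' : q != q' -> umon y q' = 0.
Proof. by move=> qq'; rewrite gtruncE; case: eqP qq' => // _ _; case: ifP. Qed.

Lemma umon_out q (y : C q) : ~~ gindex q -> umon y = 0.
Proof.
move=> nq; apply: gsumP => q' Pq'; rewrite umon_coef_neq ?[RHS]gtruncE ?Pq' //.
by apply: contraNneq nq => ->.
Qed.

Fact umon_is_linear q : linear (@umon q).
Proof.
move=> a x y; apply: gsumP => q' Pq'; rewrite coefP.
have [e|ne] := eqVneq q q'; first by subst q'; rewrite !umon_coef.
by rewrite !umon_coef_neq // scaler0 addr0.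
Qed.
HB.instance Definition _ q :=
  GRing.isLinear.Build k (C q) gsum *:%R (@umon q) (@umon_is_linear q).

(* The map out of the direct sum with restriction [F q] to the summand C_q.    *)
Definition gext (W : lmodType k) (F : forall q, C q -> W) (x : gsum) : W :=
  \sum_(q < m.+1) F q (x q).

Lemma gext_umon (W : lmodType k) (F : forall q, C q -> W) q (y : C q) :
  (forall q, linear (F q)) -> gindex q -> gext F (umon y) = F q y.
Proof.
move=> linF Pq; have qm : (q < m.+1)%N by case/andP: Pq.
rewrite /gext (bigD1 (Ordinal qm)) //= big1 ?addr0 => [|i iq]; first by rewrite umon_coef.
by rewrite umon_coef_neq ?linear_at0 // eq_sym.
Qed.

Fact gext_is_linear (W : lmodType k) (F : forall q, C q -> W) :
  (forall q, linear (F q)) -> linear (gext F).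
Proof.
move=> linF a x y; rewrite /gext scaler_sumr -big_split; apply: eq_bigr => q _.
by rewrite coefP linF.
Qed.

End GradedSum.

(* Operators acting on coefficients. *)
Section GradedMap.
Variables (k : nzRingType) (C D : nat -> lmodType k) (m : nat) (P : pred nat).
Variable g : forall q, {linear C q -> D q}.

Definition gmap (x : gsum C m P) : gsum D m P := gtrunc m P (fun q => g q (x q)).

Lemma gmapE x q : gmap x q = g q (x q).
Proof. by rewrite gtruncE; case: ifPn => // nq; rewrite coef0 // linear0. Qed.

Lemma gmap_umon q (y : C q) : gmap (umon m P y) = umon m P (g q y).
Proof.
apply: gsumP => q' Pq'; rewrite gmapE.
have [e|ne] := eqVneq q q'; first by subst q'; rewrite !umon_coef.
by rewrite !umon_coef_neq // linear0.
Qed.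

Fact gmap_is_linear : linear gmap.
Proof. by move=> a x y; apply: gsumP => q _; rewrite coefP !gmapE coefP linearP. Qed.
HB.instance Definition _ :=
  GRing.isLinear.Build k (gsum C m P) (gsum D m P) *:%R gmap gmap_is_linear.

Lemma gext_gmap (W W' : lmodType k) (F : forall q, C q -> W)
    (F' : forall q, D q -> W') (h : {linear W -> W'}) x :
  (forall q y, F' q (g q y) = h (F q y)) -> gext F' (gmap x) = h (gext F x).
Proof.
by move=> Fh; rewrite /gext linear_sum; apply: eq_bigr => q _; rewrite gmapE Fh.
Qed.

Lemma gmap_surj : (forall q y, exists x, g q x = y) -> forall y, exists x, gmap x = y.
Proof.
move=> gs y; exists (gtrunc m P (fun q => projT1 (cid (gs q (y q))))).
apply: gsumP => q Pq; by rewrite gmapE gtruncE Pq; case: (cid _).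
Qed.

End GradedMap.

Arguments umon {k C} m P {q} y.

(* [face j] on degree m.+1 is d_j, 0 <= j <= m.+1; C_m = 0 for m < 0, so there *)
(* are no face maps out of degree 0.                                           *)
Record paraPrecyclic (k : nzRingType) := ParaPrecyclic {
  chain :> nat -> lmodType k;
  face : forall m, 'I_m.+2 -> {linear chain m.+1 -> chain m};
  cyc : forall m, {linear chain m -> chain m};
  cyc_bij : forall m, bijective (cyc m);
  face_face : forall m i j (x : chain m.+2), (i < j <= m.+2)%N ->
    face (inord i) (face (inord j) x) = face (inord j.-1) (face (inord i) x);
  cyc_face : forall m i (x : chain m.+1), (i <= m)%N ->
    cyc m (face (inord i) x) = face (inord i.+1) (cyc m.+1 x);
  face_last : forall m (x : chain m.+1),
    face ord_max x = face ord0 (cyc m.+1 x) }.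

Arguments face {k} C {m} j : rename.
Arguments cyc {k} C m : rename.

Section ParaPrecyclicOps.
Variables (k : nzRingType) (C : paraPrecyclic k).
Implicit Type m : nat.

Definition opT m (x : C m) : C m := iter m.+1 (cyc C m) x.

Definition opb m (x : C m.+1) : C m := \sum_(j < m.+2) (-1) ^+ j *: face C j x.

Definition opb' m (x : C m.+1) : C m :=
  \sum_(j < m.+1) (-1) ^+ j *: face C (inord j) x.

Definition tau m (x : C m) : C m := (-1) ^+ m *: cyc C m x.

Definition opN m (x : C m) : C m := \sum_(j < m.+1) iter j (@tau m) x.

Fact sign_linear (V W : lmodType k) n (f : {linear V -> W}) :
  linear (fun x => (-1) ^+ n *: f x).
Proof.
by move=> a x y; rewrite linearP scalerDr !scalerA -signr_odd; case: odd;
  rewrite ?mulN1r ?mulrN1 ?mul1r ?mulr1.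
Qed.

Fact opT_is_linear m : linear (@opT m). Proof. exact: iter_is_linear. Qed.
HB.instance Definition _ m :=
  GRing.isLinear.Build k (C m) (C m) *:%R (@opT m) (@opT_is_linear m).

Fact opb_is_linear m : linear (@opb m).
Proof.
move=> a x y; rewrite /opb scaler_sumr -big_split; apply: eq_bigr => j _.
exact: sign_linear.
Qed.
HB.instance Definition _ m :=
  GRing.isLinear.Build k (C m.+1) (C m) *:%R (@opb m) (@opb_is_linear m).

Fact opb'_is_linear m : linear (@opb' m).
Proof.
move=> a x y; rewrite /opb' scaler_sumr -big_split; apply: eq_bigr => j _.
exact: sign_linear.
Qed.
HB.instance Definition _ m :=
  GRing.isLinear.Build k (C m.+1) (C m) *:%R (@opb' m) (@opb'_is_linear m).

Fact tau_is_linear m : linear (@tau m). Proof. exact: sign_linear. Qed.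
HB.instance Definition _ m :=
  GRing.isLinear.Build k (C m) (C m) *:%R (@tau m) (@tau_is_linear m).

Fact opN_is_linear m : linear (@opN m).
Proof.
move=> a x y; rewrite /opN scaler_sumr -big_split; apply: eq_bigr => j _.
exact: iter_is_linear.
Qed.
HB.instance Definition _ m :=
  GRing.isLinear.Build k (C m) (C m) *:%R (@opN m) (@opN_is_linear m).

Lemma face_cyc_iter m n (x : C m.+1) i : (i + n <= m.+1)%N ->
  iter n (cyc C m) (face C (inord i) x) = face C (inord (i + n)) (iter n (cyc C m.+1) x).
Proof.
elim: n => [|n IHn] in_le; first by rewrite addn0.
by rewrite addnS in in_le *; rewrite !iterS IHn ?(ltnW in_le) // cyc_face.
Qed.

Lemma face_opT m (x : C m.+1) j : face C j (opT x) = opT (face C j x).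
Proof.
have jm : (j <= m.+1)%N by rewrite -ltnS.
have ord_inord (i : 'I_m.+2) : i = inord i by rewrite inord_val.
have -> : opT (face C j x) = iter (j + (m.+1 - j)) (cyc C m) (face C j x).
  by rewrite subnKC.
rewrite iterD {4}(ord_inord j) face_cyc_iter ?subnKC //.
have -> : inord m.+1 = ord_max :> 'I_m.+2 by apply: val_inj; rewrite /= inordK.
rewrite face_last -iterS (ord_inord ord0) face_cyc_iter ?add0n // -iterD.
by rewrite addnS subnKC // -ord_inord.
Qed.

Lemma cyc_opT m (x : C m) : cyc C m (opT x) = opT (cyc C m x).
Proof. by rewrite /opT -iterS -iterSr. Qed.

Lemma opb_opT m (x : C m.+1) : opb (opT x) = opT (opb x).
Proof.
rewrite /opb linear_sum; apply: eq_bigr => j _; rewrite face_opT linearZ //.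
Qed.

Lemma opb'_opT m (x : C m.+1) : opb' (opT x) = opT (opb' x).
Proof.
by rewrite /opb' linear_sum; apply: eq_bigr => j _; rewrite face_opT linearZ.
Qed.

Lemma tau_opT m (x : C m) : tau (opT x) = opT (tau x).
Proof. by rewrite /tau cyc_opT linearZ. Qed.

Lemma opN_opT m (x : C m) : opN (opT x) = opT (opN x).
Proof.
rewrite /opN linear_sum; apply: eq_bigr => j _ /=.
by elim: (j : nat) => //= n ->; rewrite tau_opT.
Qed.

Lemma iter_tau m (x : C m) : iter m.+1 (@tau m) x = opT x.
Proof.
have it n : iter n (@tau m) x = (-1) ^+ (m * n) *: iter n (cyc C m) x.
  elim: n => [|n IHn]; first by rewrite muln0 scale1r.
  by rewrite iterS IHn /tau linearZ /= scalerA -exprD mulnS.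
by rewrite it -signr_odd oddM /= andbN scale1r.
Qed.

Lemma one_minus_tau_opN m (x : C m) :
  one_minus (@tau m) (opN x) = one_minus (@opT m) x.
Proof.
rewrite /one_minus /= -iter_tau /opN linear_sum /= -sumrB.
rewrite -(big_mkord xpredT (fun j => iter j (@tau m) x - tau (iter j (@tau m) x))).
rewrite (telescope_sumr_eq (fun j => - iter j (@tau m) x)) //= => [|j _].
  by rewrite opprK addrC.
by rewrite opprK addrC.
Qed.

Lemma opN_one_minus_tau m (x : C m) :
  opN (one_minus (@tau m) x) = one_minus (@opT m) x.
Proof.
rewrite -one_minus_tau_opN /one_minus linearB; congr (_ - _).
rewrite /opN linear_sum; apply: eq_bigr => j _ /=.
by rewrite -iterSr.
Qed.

Lemma opb_split m (x : C m.+1) :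
  opb x = opb' x + (-1) ^+ m.+1 *: face C ord_max x.
Proof.
rewrite /opb big_ord_recr; congr (_ + _); apply: eq_bigr => j _ /=.
by congr (_ *: face C _ x); apply: val_inj; rewrite /= inordK // ltnS ltnW.
Qed.

Lemma opb_one_minus_tau m (x : C m.+1) :
  opb (one_minus (@tau m.+1) x) = one_minus (@tau m) (opb' x).
Proof.
have opb_tau : opb (tau x) = tau (opb' x) + (-1) ^+ m.+1 *: face C ord_max x.
  rewrite /tau linearZ /= /opb big_ord_recl scale1r -face_last scalerDr addrC.
  congr (_ + _); rewrite linear_sum !scaler_sumr; apply: eq_bigr => j _.
  have -> : lift ord0 j = inord j.+1 by apply: val_inj; rewrite /= inordK // ltnS.
  rewrite -cyc_face -1?ltnS // linearZ !scalerA; congr (_ *: _) => /=.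
  have jm : (j.+1 < m.+2)%N by rewrite ltnS.
  by rewrite (inordK jm) !exprS !mulN1r mulrN mulNr opprK.
by rewrite /one_minus linearB /= opb_tau opb_split opprD addrACA subrr addr0.
Qed.

End ParaPrecyclicOps.

Record hUnital (k : nzRingType) := HUnital {
  para :> paraPrecyclic k;
  sdeg : forall m, {linear para m -> para m.+1};
  sdeg_opT : forall m (x : para m), sdeg m (opT x) = opT (sdeg m x);
  sdeg_htpy : forall m (x : para m),
    opb' (sdeg m x) + lowered (@opb' k para) sdeg x = x }.

Arguments sdeg {k} C m : rename.

Section HUnitalOps.
Variables (k : nzRingType) (C : hUnital k).
Implicit Type m : nat.

Definition ops' m (x : C m) : C m.+1 := sdeg C m (opb' (sdeg C m x)).

Definition opB m (x : C m) : C m.+1 := one_minus (@tau k C m.+1) (ops' (opN x)).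

Fact ops'_is_linear m : linear (@ops' m).
Proof. by move=> a x y; rewrite /ops' !linearP. Qed.
HB.instance Definition _ m :=
  GRing.isLinear.Build k (C m) (C m.+1) *:%R (@ops' m) (@ops'_is_linear m).

Fact opB_is_linear m : linear (@opB m).
Proof. by move=> a x y; rewrite /opB !linearP. Qed.
HB.instance Definition _ m :=
  GRing.isLinear.Build k (C m) (C m.+1) *:%R (@opB m) (@opB_is_linear m).

Lemma ops'_opT m (x : C m) : ops' (opT x) = opT (ops' x).
Proof. by rewrite /ops' sdeg_opT opb'_opT sdeg_opT. Qed.

Lemma one_minus_tau_opT m (x : C m) :
  one_minus (@tau k C m) (opT x) = opT (one_minus (@tau k C m) x).
Proof. by rewrite /one_minus linearB /= tau_opT. Qed.

End HUnitalOps.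

Definition even_weight : pred nat := fun r => ~~ odd r.

(* C^natural_m and C^naturalnatural_m *)
Notation natl C m := (gsum C m even_weight).
Notation natnat C m := (gsum C m xpredT).

(* C^lambda_m = C_m / ran (1 - tau) *)
Notation clam C m := (coker (one_minus (@tau _ C m))).

(* The graded operators are given by their values on the summands of degree n: *)
(* in [gext (fun q y => _)], y : C_q stands for y u^p with n = q + 2p on natl  *)
(* and n = q + p on natnat, so that the parity of p on natnat is that of       *)
(* n - q; and [umon n P z], z : C_r, for z u^p with n = r + 2p or n = r + p.   *)
Section Operators.
Variables (k : nzRingType) (C : hUnital k).
Implicit Type m : nat.

(* b + B u^-1; here u^-1 (y u^p) = 0 for p = 0, i.e. unless q <= m. *)
Definition bBu m : natl C m.+1 -> natl C m := gext (fun q (y : C q) =>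
  lowered (W := fun=> natl C m) (@opb k C) (@umon k C m even_weight) y
  + (if (q <= m)%N then umon m even_weight (opB y) else 0)).

Definition delta m : natnat C m.+1 -> natnat C m := gext (fun q (y : C q) =>
  if ~~ odd (m.+1 - q)
  then lowered (W := fun=> natnat C m) (@opb k C) (@umon k C m xpredT) y
  else - lowered (W := fun=> natnat C m) (@opb' k C) (@umon k C m xpredT) y).

Definition opI m : natl C m -> natnat C m := gext (fun q (y : C q) =>
  if q == m then umon m xpredT y
  else umon m xpredT y + umon m xpredT (ops' (opN y))).

Definition opJ m : natnat C m -> natl C m := gext (fun q (y : C q) =>
  if ~~ odd (m - q) then umon m even_weight y
  else umon m even_weight (one_minus (@tau k C q.+1) (ops' y))).

Definition pilam m (x : C m) : clam C m := cpi _ x.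

Definition pinat m (x : natl C m) : clam C m := pilam (x m).

Fact bBu_is_linear m : linear (@bBu m).
Proof.
apply: gext_is_linear => q a x y.
rewrite lowered_linear; [|by move=> *; exact: linearP..].
by case: ifP => _; rewrite ?linearP ?addr0 //= scalerDr addrACA.
Qed.
HB.instance Definition _ m := GRing.isLinear.Build k (natl C m.+1) (natl C m) *:%R
  (@bBu m) (@bBu_is_linear m).

Fact delta_is_linear m : linear (@delta m).
Proof.
apply: gext_is_linear => q a x y.
by case: ifP => _; rewrite lowered_linear ?opprD ?scalerN //; move=> *; exact: linearP.
Qed.
HB.instance Definition _ m := GRing.isLinear.Build k (natnat C m.+1) (natnat C m)
  *:%R (@delta m) (@delta_is_linear m).

Fact opI_is_linear m : linear (@opI m).
Proof.
apply: gext_is_linear => q a x y.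
by case: ifP => _; rewrite !linearP //= scalerDr addrACA.
Qed.
HB.instance Definition _ m := GRing.isLinear.Build k (natl C m) (natnat C m) *:%R
  (@opI m) (@opI_is_linear m).

Fact opJ_is_linear m : linear (@opJ m).
Proof.
by apply: gext_is_linear => q a x y; case: ifP => _; rewrite !linearP.
Qed.
HB.instance Definition _ m := GRing.isLinear.Build k (natnat C m) (natl C m) *:%R
  (@opJ m) (@opJ_is_linear m).

HB.instance Definition _ m := GRing.Linear.copy (@pilam m) (cpi (one_minus (@tau k C m))).

Fact pinat_is_linear m : linear (@pinat m).
Proof. by move=> a x y; rewrite /pinat coefP linearP. Qed.
HB.instance Definition _ m := GRing.isLinear.Build k (natl C m) (clam C m) *:%R
  (@pinat m) (@pinat_is_linear m).

(* T acting on coefficients *)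
Definition gopT m P : gsum C m P -> gsum C m P := gmap (fun q => @opT k C q).
HB.instance Definition _ m P := GRing.Linear.on (@gopT m P).

Lemma gopT_umon m P q (y : C q) : umon m P (opT y) = gopT (umon m P y).
Proof. by rewrite /gopT gmap_umon. Qed.

Lemma opI_gopT m x : opI (@gopT m _ x) = gopT (opI x).
Proof.
apply: gext_gmap => q y; case: ifP => _; first exact: gopT_umon.
by rewrite /= opN_opT ops'_opT !gopT_umon linearD.
Qed.

Lemma opJ_gopT m x : opJ (@gopT m _ x) = gopT (opJ x).
Proof.
apply: gext_gmap => q y; case: ifP => _; first exact: gopT_umon.
by rewrite /= ops'_opT one_minus_tau_opT gopT_umon.
Qed.

Lemma delta_gopT m x : delta (@gopT m.+1 _ x) = gopT (delta x).
Proof.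
apply: gext_gmap => -[|q] y; case: ifP => _ /=; rewrite ?oppr0 ?linear0 //.
  by rewrite opb_opT gopT_umon.
by rewrite opb'_opT gopT_umon linearN.
Qed.

(* A ring morphism from rat is injective and its image is central, so [iota]   *)
(* expresses that k contains the rationals.                                    *)
Section Rational.
Variable iota : {rmorphism rat -> k}.

Definition hat m (x : C m) : C m := iota (m.+1%:R)^-1 *: x.
Definition hatN m (x : C m) : C m := opN (hat x).
Definition hatD m (x : C m) : C m :=
  \sum_(j < m.+1) iter j (@tau k C m) (hat x) *+ (m - j).

Definition nu m (x : C m) : natnat C m := umon m xpredT (hatN x).

Definition phi m : natnat C m -> natnat C m.+1 := gext (fun q (y : C q) =>
  if ~~ odd (m - q) then - umon m.+1 xpredT (hatD y)
  else - umon m.+1 xpredT (hat y)).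

Definition phidelta m : natnat C m -> natnat C m :=
  @lowered k (fun n => natnat C n) (fun n => natnat C n) (fun n => natnat C n)
    delta phi m.

(* The sums over all j >= 0 are finite by [phidelta_nilpotent] below. *)
Definition phinatnat m (x : natnat C m) : natnat C m.+1 :=
  \sum_(j < m.+2) iter j (@phidelta m.+1) (phi x).
Definition nu0natnat m (x : C m) : natnat C m :=
  \sum_(j < m.+1) iter j (@phidelta m) (nu x).

Definition nu0nat m (x : C m) : natl C m := opJ (nu0natnat x).
Definition phinat m (x : natl C m) : natl C m.+1 := opJ (phinatnat (opI x)).

Fact hat_is_linear m : linear (@hat m).
Proof.
have comm_inv (a : k) n : GRing.comm a (iota (n.+1%:R)^-1).
  rewrite /GRing.comm; set q := iota _.
  have qn : q * n.+1%:R = 1.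
    rewrite -(rmorph_nat iota n.+1) -rmorphM mulVf ?rmorph1 //.
    by rewrite Num.Theory.pnatr_eq0.
  rewrite -[LHS]mul1r -[in LHS]qn -!mulrA (mulrA n.+1%:R) -(commr_nat a n.+1).
  by rewrite -(mulrA a) -(commr_nat q n.+1) qn mulr1.
by move=> a x y; rewrite /hat scalerDr !scalerA comm_inv.
Qed.
HB.instance Definition _ m :=
  GRing.isLinear.Build k (C m) (C m) *:%R (@hat m) (@hat_is_linear m).

Lemma hat_opT m (x : C m) : hat (opT x) = opT (hat x).
Proof. by rewrite /hat linearZ. Qed.

Fact hatD_is_linear m : linear (@hatD m).
Proof.
move=> a x y; rewrite /hatD scaler_sumr -big_split; apply: eq_bigr => j _ /=.
by rewrite linearP iter_is_linear mulrnDl scalerMnr.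
Qed.
HB.instance Definition _ m :=
  GRing.isLinear.Build k (C m) (C m) *:%R (@hatD m) (@hatD_is_linear m).

Lemma hatD_opT m (x : C m) : hatD (opT x) = opT (hatD x).
Proof.
rewrite /hatD linear_sum; apply: eq_bigr => j _ /=; rewrite linearMn hat_opT.
by congr (_ *+ _); elim: (j : nat) => //= n ->; rewrite tau_opT.
Qed.

Fact nu_is_linear m : linear (@nu m).
Proof. by move=> a x y; rewrite /nu /hatN !linearP. Qed.
HB.instance Definition _ m := GRing.isLinear.Build k (C m) (natnat C m) *:%R
  (@nu m) (@nu_is_linear m).

Fact phi_is_linear m : linear (@phi m).
Proof.
by apply: gext_is_linear => q a x y; case: ifP => _; rewrite !linearP.
Qed.
HB.instance Definition _ m := GRing.isLinear.Build k (natnat C m) (natnat C m.+1)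
  *:%R (@phi m) (@phi_is_linear m).

Fact phidelta_is_linear m : linear (@phidelta m).
Proof. by apply: lowered_linear => *; exact: linearP. Qed.
HB.instance Definition _ m := GRing.isLinear.Build k (natnat C m) (natnat C m)
  *:%R (@phidelta m) (@phidelta_is_linear m).

Fact phinatnat_is_linear m : linear (@phinatnat m).
Proof.
move=> a x y; rewrite /phinatnat scaler_sumr -big_split; apply: eq_bigr => j _.
by rewrite linearP iter_is_linear.
Qed.
HB.instance Definition _ m := GRing.isLinear.Build k (natnat C m) (natnat C m.+1)
  *:%R (@phinatnat m) (@phinatnat_is_linear m).

Fact nu0natnat_is_linear m : linear (@nu0natnat m).
Proof.
move=> a x y; rewrite /nu0natnat scaler_sumr -big_split; apply: eq_bigr => j _.
by rewrite linearP iter_is_linear.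
Qed.
HB.instance Definition _ m := GRing.isLinear.Build k (C m) (natnat C m)
  *:%R (@nu0natnat m) (@nu0natnat_is_linear m).

Fact nu0nat_is_linear m : linear (@nu0nat m).
Proof. by move=> a x y; rewrite /nu0nat !linearP. Qed.
HB.instance Definition _ m := GRing.isLinear.Build k (C m) (natl C m)
  *:%R (@nu0nat m) (@nu0nat_is_linear m).

Fact phinat_is_linear m : linear (@phinat m).
Proof. by move=> a x y; rewrite /phinat !linearP. Qed.
HB.instance Definition _ m := GRing.isLinear.Build k (natl C m) (natl C m.+1)
  *:%R (@phinat m) (@phinat_is_linear m).

Lemma phi_gopT m x : phi (@gopT m _ x) = gopT (phi x).
Proof.
apply: gext_gmap => q y; case: ifP => _ /=.
  by rewrite hatD_opT gopT_umon linearN.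
by rewrite hat_opT gopT_umon linearN.
Qed.

Lemma phidelta_gopT m x : phidelta (@gopT m _ x) = gopT (phidelta x).
Proof.
by case: m x => [|m] x; rewrite /phidelta /= ?linear0 // delta_gopT phi_gopT.
Qed.

Lemma iter_phidelta_gopT m n x :
  iter n (@phidelta m) (gopT x) = gopT (iter n (@phidelta m) x).
Proof. by elim: n => //= n ->; rewrite phidelta_gopT. Qed.

Lemma phinat_gopT m x : phinat (@gopT m _ x) = gopT (phinat x).
Proof.
rewrite /phinat opI_gopT -opJ_gopT; congr opJ; rewrite /phinatnat [RHS]linear_sum.
by apply: eq_bigr => j _; rewrite phi_gopT iter_phidelta_gopT.
Qed.

Lemma nu0nat_one_minus_tau m (x : C m) :
  nu0nat (one_minus (@tau k C m) x) = one_minus (@gopT m _) (opJ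
    (\sum_(j < m.+1) iter j (@phidelta m) (umon m xpredT (hat x)))).
Proof.
rewrite /one_minus /= -opJ_gopT -linearB /nu0nat; congr opJ.
rewrite /nu0natnat linear_sum -sumrB; apply: eq_bigr => j _ /=.
rewrite -iter_phidelta_gopT.
have -> : nu (x - tau x) = umon m xpredT (hat x) - gopT (umon m xpredT (hat x)).
  have hat_tau : hat (tau x) = tau (hat x).
    by rewrite /hat /tau linearZ /= !scalerA (commr_sign _ m).
  rewrite /nu /hatN linearB /= hat_tau.
  by rewrite -[_ - tau _]/(one_minus (@tau k C m) _) opN_one_minus_tau /one_minus
    linearB /= gopT_umon.
have := iter_is_linear (@phidelta m) j (-1) (gopT (umon m xpredT (hat x)))
  (umon m xpredT (hat x)).
by rewrite !scaleN1r [X in iter j _ X]addrC => ->; rewrite addrC.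
Qed.

Definition below n m (x : natnat C m) := forall q, (n <= q)%N -> x q = 0.

Lemma below_gext n n' m m' (F : forall q, C q -> natnat C m') (x : natnat C m) :
  (forall q y, (q < n)%N -> below n' (F q y)) -> (forall q, linear (F q)) ->
  below n x -> below n' (gext F x).
Proof.
move=> Fb linF xb q nq; rewrite -[LHS]/(coef_at q _) /gext linear_sum big1 // => i _.
have [lt_in|/xb ->] := ltnP i n; first exact: Fb nq.
by rewrite linear_at0 // linear0.
Qed.

Lemma below_umon q (y : C q) n m : (q < n)%N -> below n (umon m xpredT y).
Proof. by move=> qn r nr; rewrite umon_coef_neq // ltn_eqF // (leq_trans qn). Qed.

Lemma belowN n m (x : natnat C m) : below n x -> below n (- x).
Proof. by move=> xb q nq; rewrite -[LHS]/(coef_at q _) linearN /= /coef_at xb // oppr0. Qed.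

Lemma below_phi n m (x : natnat C m) : below n x -> below n (phi x).
Proof.
apply: below_gext => [q y qn|q a y z]; last by case: ifP => _; rewrite !linearP.
by case: ifP => _; apply/belowN/below_umon.
Qed.

Lemma below_delta n m (x : natnat C m.+1) : below n x -> below n.-1 (delta x).
Proof.
apply: below_gext => [[|q] y qn|q a y z] /=.
- by case: ifP => _ r _; rewrite ?oppr0 gtruncE; case: ifP.
- case: n qn => // n qn.
  by case: ifP => _; [exact: below_umon | apply/belowN/below_umon].
- by case: ifP => _; rewrite lowered_linear ?opprD ?scalerN //; move=> *; exact: linearP.
Qed.

Lemma phidelta_nilpotent m (x : natnat C m) : iter m.+1 (@phidelta m) x = 0.
Proof.
case: m x => [|m] x //.
have key n : below (m.+2 - n) (iter n (@phidelta m.+1) x).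
  elim: n => [|n IHn]; first by move=> q mq; rewrite coef0 // /gindex andbT -ltnNge.
  by rewrite subnS iterS; apply/below_phi/below_delta.
by apply: gsumP => q _; rewrite key ?subnn // -[RHS]/(coef_at q 0) linear0.
Qed.

End Rational.
End Operators.

(* C_T = C / ran (1 - T), with the induced structure. *)
Section TQuotient.
Variables (k : nzRingType) (C : paraPrecyclic k).

Definition tquot m : lmodType k := coker (one_minus (@opT k C m)).

Definition piT m : C m -> tquot m := @cpi k _ _ (one_minus (@opT k C m)).
HB.instance Definition _ m :=
  GRing.Linear.copy (@piT m) (cpi (one_minus (@opT k C m))).

Lemma piT_surj m q : exists x, @piT m x = q. Proof. exact: cpi_surj. Qed.

Lemma piT_opT m (x : C m) : piT (opT x) = piT x.
Proof.
by apply/esym/eqP; rewrite -subr_eq0 -linearB; apply/eqP/cpi_eq0; exists x.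
Qed.

Lemma ker_piT m (x : C m) : piT x = 0 -> exists y, x = one_minus (@opT k C m) y.
Proof. by move/cpi_eq0 => [y <-]; exists y. Qed.

Fact tmap_subproof m n (f : {linear C m -> C n}) :
  (forall x, f (opT x) = opT (f x)) -> forall x, piT x = 0 -> (@piT n \o f) x = 0.
Proof.
by move=> fT _ /ker_piT[y ->]; rewrite /one_minus /= !linearB /= fT piT_opT subrr.
Qed.

Definition tmap m n (f : {linear C m -> C n}) (fT : forall x, f (opT x) = opT (f x)) :
  {linear tquot m -> tquot n} := descend (@piT_surj m) (tmap_subproof fT).

Lemma tmapE m n f fT x : @tmap m n f fT (piT x) = piT (f x).
Proof. exact: descendE. Qed.

Definition tface m (j : 'I_m.+2) : {linear tquot m.+1 -> tquot m} :=
  tmap (fun x => face_opT x j).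
Definition tcyc m : {linear tquot m -> tquot m} := tmap (@cyc_opT k C m).

Fact tcyc_bij m : bijective (tcyc m).
Proof.
have [g gK Kg] := cyc_bij C m.
have gT x : g (opT x) = opT (g x) by rewrite -{1}[x]Kg -cyc_opT gK.
have g_lin : linear g by move=> a x y; rewrite -{1}[x]Kg -{1}[y]Kg -linearP gK.
pose G : {linear C m -> C m} := HB.pack g (GRing.isLinear.Build k _ _ _ g g_lin).
exists (@tmap m m G gT) => q; have [x <-] := piT_surj q; rewrite /tcyc !tmapE /=.
  by rewrite gK.
by rewrite Kg.
Qed.

Fact tface_face m i j (q : tquot m.+2) : (i < j <= m.+2)%N ->
  tface (inord i) (tface (inord j) q) = tface (inord j.-1) (tface (inord i) q).
Proof.
by have [x <-] := piT_surj q => ij; rewrite /tface !tmapE face_face.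
Qed.

Fact tcyc_face m i (q : tquot m.+1) : (i <= m)%N ->
  tcyc m (tface (inord i) q) = tface (inord i.+1) (tcyc m.+1 q).
Proof.
by have [x <-] := piT_surj q => im; rewrite /tface /tcyc !tmapE cyc_face.
Qed.

Fact tface_last m (q : tquot m.+1) :
  tface ord_max q = tface ord0 (tcyc m.+1 q).
Proof.
by have [x <-] := piT_surj q; rewrite /tface /tcyc !tmapE face_last.
Qed.

Definition tpara : paraPrecyclic k :=
  @ParaPrecyclic k tquot tface tcyc tcyc_bij tface_face tcyc_face tface_last.

Lemma opT_tpara m (q : tpara m) : opT q = q.
Proof.
have [x <-] := piT_surj q; rewrite -[RHS](piT_opT x).
have it n : iter n (cyc tpara m) (piT x) = piT (iter n (cyc C m) x).
  by elim: n => // n IHn; rewrite !iterS IHn; exact: (tmapE (@cyc_opT k C m)).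
exact: it.
Qed.

Lemma opb'_tpara m (x : C m.+1) : @opb' k tpara m (piT x) = piT (opb' x).
Proof.
rewrite /opb' linear_sum; apply: eq_bigr => j _; rewrite linearZ.
by congr (_ *: _); exact: (tmapE (fun x => face_opT x (inord j))).
Qed.

End TQuotient.

Section HTQuotient.
Variables (k : nzRingType) (C : hUnital k).

Definition tsdeg m : {linear tpara C m -> tpara C m.+1} :=
  tmap (@sdeg_opT k C m).

Fact tsdeg_opT m (q : tpara C m) : tsdeg m (opT q) = opT (tsdeg m q).
Proof. by rewrite !opT_tpara. Qed.

Fact tsdeg_htpy m (q : tpara C m) :
  opb' (tsdeg m q) + lowered (@opb' k (tpara C)) tsdeg q = q.
Proof.
have [x <-] := piT_surj q; rewrite -[in RHS](sdeg_htpy x) linearD.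
rewrite /tsdeg tmapE opb'_tpara; congr (_ + _).
case: m x {q} => [|m] x; first by rewrite /= linear0.
rewrite -[LHS]/(tmap (@sdeg_opT k C m) (@opb' k (tpara C) m (piT x))).
by rewrite opb'_tpara tmapE.
Qed.

Definition hquotT : hUnital k := @HUnital k (tpara C) tsdeg tsdeg_opT tsdeg_htpy.

End HTQuotient.

(* The maps induced on C_T^natural = C^natural of C_T, and on C^lambda. *)
Section Descended.
Variables (k : nzRingType) (C : hUnital k).
Local Notation CT := (hquotT C).

Fact oplam_subproof m (x : C m.+1) : pilam x = 0 -> (@pilam k C m \o @opb k C m) x = 0.
Proof.
by move/cpi_eq0 => [y <-] /=; rewrite opb_one_minus_tau; apply/cpi_eq0; exists (opb' y).
Qed.

(* The graded modules C_T^natural and C^lambda, and b + B u^-1 on the former. *)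
Definition natlT : nat -> lmodType k := fun m => natl CT m.
Definition lam : nat -> lmodType k := fun m => clam C m.
Definition dnatlT m : {linear natlT m.+1 -> natlT m} := @bBu k CT m.

(* b on C^lambda *)
Definition blam m : {linear lam m.+1 -> lam m} :=
  descend (@cpi_surj k _ _ _) (@oplam_subproof m).

Lemma blamE m (x : C m.+1) : blam m (pilam x) = pilam (opb x).
Proof. exact: descendE. Qed.

Definition piTnat m : natl C m -> natl CT m := gmap (D := CT) (@piT k C).
HB.instance Definition _ m := GRing.Linear.on (@piTnat m).

Lemma piTnat_surj m y : exists x, @piTnat m x = y.
Proof. by apply: gmap_surj => q z; exact: piT_surj. Qed.

Lemma ker_piTnat m (x : natl C m) :
  piTnat x = 0 -> exists y, x = one_minus (@gopT k C m even_weight) y.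
Proof.
move=> x0; have xq q : exists y, x q = one_minus (@opT k C q) y.
  apply: ker_piT; rewrite -[piT _](gmapE (D := CT)) -/(piTnat x) x0.
  by rewrite -[LHS]/(coef_at q 0) linear0.
exists (gtrunc m even_weight (fun q => projT1 (cid (xq q)))).
apply: gsumP => q Pq; rewrite /one_minus /= -[RHS]/(coef_at q _) linearB /= /coef_at.
by rewrite gmapE gtruncE Pq; case: cid.
Qed.

Lemma piTnat_gopT m (x : natl C m) : piTnat (gopT x) = piTnat x.
Proof.
by apply: gsumP => q _; rewrite !(gmapE (D := CT)) /= gmapE piT_opT.
Qed.

Fact barpi_subproof m (x : natl C m) : piTnat x = 0 -> pinat x = 0.
Proof.
move/ker_piTnat => [y ->].
rewrite -[pinat _]/(pilam (coef_at m (y - gopT y))) [coef_at _ _]linearB.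
rewrite /= /coef_at gmapE; apply/cpi_eq0; exists (opN (y m)).
exact: one_minus_tau_opN.
Qed.

Definition barpi m : {linear natlT m -> lam m} :=
  descend (@piTnat_surj m) (@barpi_subproof m).

Lemma barpiE m (x : natl C m) : barpi m (piTnat x) = pinat x.
Proof. exact: descendE. Qed.

Section DescendedRational.
Variable iota : {rmorphism rat -> k}.

Fact barnu_subproof m (x : C m) :
  pilam x = 0 -> (@piTnat m \o @nu0nat k C iota m) x = 0.
Proof.
move/cpi_eq0 => [y <-]; rewrite /= nu0nat_one_minus_tau /one_minus linearB /=.
by rewrite piTnat_gopT subrr.
Qed.

Definition barnu m : {linear lam m -> natlT m} :=
  descend (@cpi_surj k _ _ _) (@barnu_subproof m).

Lemma barnuE m (x : C m) : barnu m (pilam x) = piTnat (nu0nat iota x).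
Proof. exact: descendE. Qed.

Fact barphi_subproof m (x : natl C m) :
  piTnat x = 0 -> (@piTnat m.+1 \o @phinat k C iota m) x = 0.
Proof.
move/ker_piTnat => [y ->]; rewrite /one_minus /= !linearB /= phinat_gopT.
by rewrite piTnat_gopT subrr.
Qed.

Definition barphi m : {linear natlT m -> natlT m.+1} :=
  descend (@piTnat_surj m) (@barphi_subproof m).

Lemma barphiE m (x : natl C m) : barphi m (piTnat x) = piTnat (phinat iota x).
Proof. exact: descendE. Qed.

End DescendedRational.
End Descended.

Definition is_complex (k : nzRingType) (V : nat -> lmodType k)
    (d : forall m, {linear V m.+1 -> V m}) :=
  forall m x, d m (d m.+1 x) = 0.

Definition chain_map (k : nzRingType) (V W : nat -> lmodType k)
    (dV : forall m, {linear V m.+1 -> V m}) (dW : forall m, {linear W m.+1 -> W m})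
    (f : forall m, {linear V m -> W m}) :=
  forall m x, f m (dV m x) = dW m (f m.+1 x).

(* The chain maps f and g form a deformation retract of (V, dV) to (W, dW). *)
Definition deformation_retract (k : nzRingType) (V W : nat -> lmodType k)
    (dV : forall m, {linear V m.+1 -> V m}) (dW : forall m, {linear W m.+1 -> W m})
    (f : forall m, {linear V m -> W m}) (g : forall m, {linear W m -> V m}) :=
  [/\ is_complex dV /\ is_complex dW, chain_map dV dW f, chain_map dW dV g,
      forall m x, f m (g m x) = x &
      exists h : forall m, {linear V m -> V m.+1},
        forall m x, g m (f m x) - x = dV m (h m x) + lowered dV h x].

(* Main.v *)
Require Import Defs.
From HB Require Import structures.
From mathcomp Require Import all_boot all_order all_algebra.

Set Implicit Arguments.
Unset Strict Implicit.
Unset Printing Implicit Defensive.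

Import GRing.Theory.
Local Open Scope ring_scope.

(** Let V be C^naturalnatural with the total differential d = delta + r, where
    r is the row differential of the cyclic bicomplex,
      r (x u^(2p)) = (N x) u^(2p-1),   r (x u^(2p+1)) = ((1 - tau) x) u^(2p)
    (and N x u^(-1) = 0).  Everything rests on five facts, all of which hold on
    C itself, before dividing by ran (1 - T).

    - delta^2 = 0 and delta r = - r delta, that is b^2 = b'^2 = 0,
      b (1 - tau) = (1 - tau) b' and N b = b' N ([opN_opb]).
    - Over the rationals the rows of the bicomplex are contractible away from
      u^0, because (1 - tau) D^ = D^ (1 - tau) = 1 - N^; that is, with pi_0 the
      u^0-coefficient, r phi + phi r = nu pi_0 - 1 ([drow_phi]).
    - The perturbation delta is absorbed by the geometric series in P = phi delta.
      The series S = phinatnat and nu_0 = nu0natnat satisfy S = phi + P S and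
      nu_0 = nu + P nu_0.  It follows that the defect
      E = 1 + d S + S d - nu_0 pi_0 satisfies E = P E, hence E = 0 as P is
      nilpotent ([phinatnat_homotopy]).
    - s'^2 = 0 and b' s' + s' b' = 1, so that I and J intertwine d and
      b + B u^-1 exactly, and J I = 1 ([dnatnat_opI], [opJ_dnatnat],
      [opJ_opI]).
    - Conjugation by I and J turns E = 0 into
      nu_0^natural pi_0 = 1 + (b + B u^-1) phi^natural
                            + phi^natural (b + B u^-1)   ([natl_homotopy]).

    This last identity descends to C_T and is the second formula.  The other two
    formulas only need u^0-coefficients: phi produces none, so that of nu_0 x is
    N^ x, which is x modulo ran (1 - tau), and that of S is 0; moreover J changes
    the u^0-coefficient by an element of ran (1 - tau) only.

    The relation T = 1 enters just once: r^2 multiplies by (1 - T) u^-2, so d^2,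
    and with it (b + B u^-1)^2 = J d^2 I, vanishes on C_T.  Finally, a map nu with
    pi nu = 1 and nu pi = 1 + d h + h d, where pi is a chain map and d^2 = 0, is
    itself a chain map; this settles the compatibility of nu^natural with the
    differentials. *)

(** * Simplicial and cyclic identities *)

(** The cancellation behind b^2 = 0 and b'^2 = 0, on the index rectangle
    i < n, j <= n: enlarging n by one adds a row and a column, which cancel. *)
Lemma alternating_double_sum0 (k : nzRingType) (V : lmodType k)
    (a : nat -> nat -> V) n :
  (forall i j, (i < j <= n)%N -> a i j = a j.-1 i) ->
  \sum_(i < n) \sum_(j < n.+1) (-1) ^+ (i + j) *: a i j = 0.
Proof.
elim: n => [|n IHn] a_sym; first by rewrite big_ord0.
under eq_bigr => i _ do rewrite big_ord_recr.
rewrite big_split big_ord_recr IHn /= ?add0r => [|i j /andP[ij jn]]; last first.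
  by rewrite a_sym // ij ltnW.
rewrite -big_split big1 // => j _; rewrite /= (a_sym j n.+1) ?ltn_ord ?leqnn //=.
by rewrite addnS exprS mulN1r scaleNr addnC subrr.
Qed.

Section SignedFaces.
Variables (k : nzRingType) (C : paraPrecyclic k).

(** The sign makes the cyclic relations sign-free: with e_j for [sface j],
    tau e_j = e_(j+1) tau and e_(m+1) = e_0 tau in degree m + 1. *)
Definition sface m j (x : C m.+1) : C m := (-1) ^+ j *: face C (inord j) x.

Lemma opb'E m (x : C m.+1) : opb' x = \sum_(j < m.+1) sface j x.
Proof. by []. Qed.

Lemma opbE m (x : C m.+1) : opb x = \sum_(j < m.+2) sface j x.
Proof. by apply: eq_bigr => j _; rewrite /sface inord_val. Qed.

Lemma sum_sface_sface m n (x : C m.+2) : (n <= m.+2)%N ->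
  \sum_(i < n) sface i (\sum_(j < n.+1) sface j x) = 0.
Proof.
move=> nm; rewrite -[RHS](@alternating_double_sum0 k (C m)
  (fun i j => face C (inord i) (face C (inord j) x)) n); last first.
  move=> i j /andP[ij jn]; apply: face_face.
  by rewrite ij (leq_trans jn).
apply: eq_bigr => i _; rewrite /sface linear_sum scaler_sumr.
by apply: eq_bigr => j _; rewrite linearZ scalerA exprD.
Qed.

Lemma opb_opb m (x : C m.+2) : opb (opb x) = 0.
Proof. by rewrite !opbE sum_sface_sface. Qed.

Lemma opb'_opb' m (x : C m.+2) : opb' (opb' x) = 0.
Proof. by rewrite !opb'E sum_sface_sface. Qed.

Lemma tau_sface m j (x : C m.+1) : (j <= m)%N ->
  tau (sface j x) = sface j.+1 (tau x).
Proof.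
move=> jm; rewrite /tau /sface !linearZ /= cyc_face // !scalerA -!exprD.
by rewrite addSn addnS addnC !exprS !mulN1r opprK.
Qed.

Lemma sface_last m (x : C m.+1) : sface m.+1 x = sface 0 (tau x).
Proof.
rewrite /sface /tau linearZ /= scale1r; congr (_ *: _).
have -> : inord m.+1 = ord_max :> 'I_m.+2 by apply: val_inj; rewrite /= inordK.
by rewrite face_last; congr (face C _ _); apply: val_inj; rewrite /= inordK.
Qed.

Lemma iter_tau_sface m i j (x : C m.+1) : (i + j <= m.+1)%N ->
  iter i (@tau k C m) (sface j x) = sface (i + j) (iter i (@tau k C m.+1) x).
Proof. by elim: i => // i IHi ij; rewrite !iterS IHi ?(ltnW ij) // addSn tau_sface. Qed.

(** In a product tau^n e_a with n + a > m the face index passes the last face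
    e_(m+1) = e_0 tau, which costs one extra tau on the right. *)
Lemma iter_tau_sface_wrap m i j (x : C m.+1) : (i + j <= m)%N ->
  iter (i + j) (@tau k C m) (sface (m.+1 - j) x) =
  sface i (iter (i + j).+1 (@tau k C m.+1) x).
Proof.
move=> ij; have im : (i <= m.+1)%N by rewrite leqW // (leq_trans (leq_addr j i)).
have jm : (j <= m.+1)%N by rewrite leqW // (leq_trans (leq_addl i j)).
rewrite iterD iter_tau_sface subnKC // sface_last iter_tau_sface addn0 //.
by rewrite -[tau _]iterS -iterD addnS.
Qed.

(** Moving the powers of tau to the right in N b = sum tau^i e_j yields each
    e_a tau^i with a <= m and i <= m + 1 exactly once: those with i <= a come from
    tau^i, those with a < i from tau^(i-1) after a wrap. *)
Lemma opN_opb m (x : C m.+1) : opN (opb x) = opb' (opN x).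
Proof.
pose e i a := sface a (iter i (@tau k C m.+1) x).
have row i : (i <= m)%N -> iter i (@tau k C m) (opb x) =
    \sum_(i <= a < m.+1) e i a + \sum_(0 <= a < i.+1) e i.+1 a.
  (* A bundled copy of the iterate, so that it distributes over sums. *)
  move=> im; have iter_lin := iter_is_linear (@tau k C m) i.
  pose ti : {linear C m -> C m} :=
    HB.pack (iter i (@tau k C m)) (GRing.isLinear.Build k _ _ _ _ iter_lin).
  rewrite -[iter _ _ _]/(ti _) opbE linear_sum.
  rewrite -(big_mkord xpredT (fun j => ti (sface j x))).
  rewrite (@big_cat_nat _ _ _ (m.+1 - i)) //=; last by rewrite leqW // leq_subr.
  congr (_ + _).
    have := big_addn 0 m.+1 i xpredT (e i); rewrite add0n => ->.
    apply: eq_big_nat => j /andP[_ ji]; rewrite ltn_subRL in ji; rewrite [LHS]/=.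
    by rewrite iter_tau_sface ?(ltnW ji) // addnC.
  have e2 : m.+2 = (i.+1 + (m.+1 - i))%N by rewrite addSn subnKC // leqW.
  have := big_addn 0 m.+2 (m.+1 - i) xpredT (fun j => ti (sface j x)).
  rewrite add0n => ->; rewrite {1}e2 addnK.
  apply: eq_big_nat => j /andP[_ ji].
  have -> : (j + (m.+1 - i) = m.+1 - (i - j))%N.
    by rewrite subnBA // addnC addnBAC // leqW.
  have wrap := @iter_tau_sface_wrap m j (i - j) x; rewrite subnKC // in wrap.
  exact: wrap.
rewrite {1}/opN; under eq_bigr => i _ do rewrite row -1?ltnS //.
rewrite big_split /=.
(* Both triangles are completed by an empty row, i = m + 1 and i = 0. *)
have -> : \sum_(i < m.+1) \sum_(i <= a < m.+1) e i a =
    \sum_(i < m.+2) \sum_(i <= a < m.+1) e i a.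
  by rewrite [RHS]big_ord_recr /= [X in _ + X]big_geq ?addr0.
have -> : \sum_(i < m.+1) \sum_(0 <= a < i.+1) e i.+1 a =
    \sum_(i < m.+2) \sum_(0 <= a < i) e i a.
  by rewrite [RHS]big_ord_recl /= [X in _ = X + _]big_geq ?add0r.
rewrite -big_split [in RHS]/opN linear_sum; apply: eq_bigr => i _ /=.
rewrite addrC -big_cat_nat //= -1?ltnS //.
by rewrite big_mkord.
Qed.

End SignedFaces.

(** * The normalized contracting homotopy s' *)

Section ContractingHomotopy.
Variables (k : nzRingType) (C : hUnital k).

Lemma sdeg_htpyS m (x : C m.+1) : opb' (sdeg C _ x) = x - sdeg C _ (opb' x).
Proof. by rewrite -[X in _ = X - _](sdeg_htpy x) /= addrK. Qed.

Lemma opb'_sdeg_opb' m (x : C m.+1) : opb' (sdeg C m (opb' x)) = opb' x.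
Proof.
case: m x => [|m] x; last by rewrite sdeg_htpyS opb'_opb' linear0 subr0.
by have := sdeg_htpy (opb' x); rewrite /= addr0.
Qed.

Lemma ops'_ops' m (x : C m) : ops' (ops' x) = 0.
Proof. by rewrite /ops' sdeg_htpyS opb'_sdeg_opb' subrr linear0. Qed.

Lemma ops'_htpy m (x : C m) :
  opb' (ops' x) + lowered (@opb' k C) (@ops' k C) x = x.
Proof.
rewrite /ops' opb'_sdeg_opb' -[RHS]sdeg_htpy; congr (_ + _).
by case: m x => [|m] x //=; rewrite opb'_sdeg_opb'.
Qed.

(** N B = (1 - T) s' N, which s' kills since it commutes with T; this is why I
    intertwines the differentials on C itself and not only on C_T. *)
Lemma ops'_opN_opB m (x : C m) : ops' (opN (opB x)) = 0.
Proof.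
rewrite /opB opN_one_minus_tau /one_minus linearB /=.
by rewrite ops'_opT ops'_ops' linear0 subrr.
Qed.

(** The counterpart of [ops'_opN_opB] for J. *)
Lemma opB_one_minus_tau_ops' m (x : C m) :
  opB (one_minus (@tau k C m.+1) (ops' x)) = 0.
Proof.
rewrite /opB opN_one_minus_tau /one_minus linearB /=.
by rewrite ops'_opT ops'_ops' linear0 subrr linear0 subrr.
Qed.

(** (1 - tau) applied to b' s' + s' b' = 1. *)
Lemma opb_one_minus_tau_ops' m (x : C m) :
  opb (one_minus (@tau k C m.+1) (ops' x)) +
  lowered (@opb' k C) (fun n y => one_minus (@tau k C n.+1) (ops' y)) x =
  one_minus (@tau k C m) x.
Proof.
rewrite opb_one_minus_tau -[X in _ = one_minus _ X]ops'_htpy linearD; congr (_ + _).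
by case: m x => [|m] x //=; rewrite linear0.
Qed.

End ContractingHomotopy.

(** * Coefficients of graded maps *)

(** Two graded maps are compared coefficient by coefficient.  As [x q] is 0 off
    the summands of x, most coefficient formulas need no case distinction at the
    ends of the range of degrees. *)
Section Coefficients.
Variables (k : nzRingType) (C : nat -> lmodType k).

Lemma gcoefD m P (x y : gsum C m P) q : (x + y) q = x q + y q.
Proof. exact: (linearD (coef_at q)). Qed.

Lemma gcoefN m P (x : gsum C m P) q : (- x) q = - x q.
Proof. exact: (linearN (coef_at q)). Qed.

Lemma gcoef0 m P q : (0 : gsum C m P) q = 0.
Proof. exact: (linear0 (coef_at q)). Qed.

Lemma coef_gt m P (x : gsum C m P) q : (m < q)%N -> x q = 0.
Proof. by move=> mq; rewrite Defs.coef0 // /gindex leqNgt mq. Qed.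

Lemma umonE m P q (y : C q) : umon m P y q = if gindex m P q then y else 0.
Proof. by case: ifP => [/umon_coef ->|/negbT nq] //; rewrite Defs.coef0. Qed.

Lemma gext_coef m P m' P' (F : forall q, C q -> gsum C m' P') (x : gsum C m P) q r :
  (forall q, linear (F q)) -> (forall i (y : C i), i != r -> F i y q = 0) ->
  gext F x q = F r (x r) q.
Proof.
move=> linF F0; rewrite -[LHS]/(coef_at q _) /gext linear_sum.
have [rm|mr] := ltnP r m.+1.
  rewrite (bigD1 (Ordinal rm)) //= big1 ?addr0 // => i ir.
  exact: F0 ir.
rewrite big1 => [|i _]; first by rewrite (coef_gt x mr) linear_at0 // gcoef0.
by apply: F0; rewrite ltn_eqF // (leq_trans (ltn_ord i)).
Qed.

(** The degree-q coefficient of the image of x under a degree-raising map acting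
    on coefficients; the case q = 0 has no source. *)
Definition raised (f : forall q, C q -> C q.+1) (x : forall q, C q) q : C q :=
  if q is q'.+1 then f q' (x q') else 0.

Lemma gext_raised m P m' P' (f : forall q, {linear C q -> C q.+1}) (x : gsum C m P) q :
  gindex m' P' q ->
  gext (fun q y => umon m' P' (f q y)) x q = raised f x q.
Proof.
move=> Pq; case: q Pq => [|q] Pq.
  rewrite -[LHS]/(coef_at _ _) /gext linear_sum big1 // => i _.
  exact: umon_coef_neq.
rewrite (@gext_coef _ _ _ _ _ _ _ q) => [|i a y z|i y iq].
- by rewrite umon_coef.
- by rewrite !linearP.
- by rewrite umon_coef_neq.
Qed.

Lemma gextD m P (W : lmodType k) (F G : forall q, C q -> W) (x : gsum C m P) :
  gext (fun q y => F q y + G q y) x = gext F x + gext G x.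
Proof. exact: big_split. Qed.

End Coefficients.

Section CoefficientFormulas.
Variables (k : nzRingType) (C : hUnital k).

Lemma parity_succ m q : (q <= m)%N -> odd (m.+1 - q) = ~~ odd (m - q).
Proof. by move=> qm; rewrite subSn. Qed.

Lemma delta_coef m (x : natnat C m.+1) q :
  delta x q = if ~~ odd (m - q) then opb (x q.+1) else - opb' (x q.+1).
Proof.
rewrite /delta (@gext_coef _ _ _ _ _ _ _ _ _ q.+1) => [|i a y z|[|i] y iq].
- rewrite subSS; case: ifP => _; rewrite ?gcoefN umonE /gindex andbT.
    by have [//|mq] := leqP q m; rewrite coef_gt ?linear0.
  by have [//|mq] := leqP q m; rewrite coef_gt ?linear0.
- by case: ifP => _; rewrite lowered_linear ?opprD ?scalerN //; move=> *; exact: linearP.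
- by case: ifP => _; rewrite /= ?oppr0 gcoef0.
- by case: ifP => _; rewrite /= ?gcoefN umon_coef_neq ?oppr0.
Qed.

(** The row differentials N and 1 - tau of the cyclic bicomplex.  For q = m + 1,
    which is the exponent 0 of u, [umon m] has no summand C_q and yields 0. *)
Definition drow m : natnat C m.+1 -> natnat C m := gext (fun q (y : C q) =>
  if ~~ odd (m.+1 - q) then umon m xpredT (opN y)
  else umon m xpredT (one_minus (@tau k C q) y)).

Lemma drow_coef m (x : natnat C m.+1) q : (q <= m)%N ->
  drow x q = if odd (m - q) then opN (x q) else one_minus (@tau k C q) (x q).
Proof.
move=> qm; have Pq : gindex m xpredT q by rewrite /gindex qm.
rewrite /drow (@gext_coef _ _ _ _ _ _ _ _ _ q) => [|i a y z|i y iq].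
- by rewrite parity_succ // negbK; case: ifP => _; rewrite umon_coef.
- by case: ifP => _; rewrite !linearP.
- by case: ifP => _; rewrite umon_coef_neq.
Qed.

Fact drow_is_linear m : linear (@drow m).
Proof.
by apply: gext_is_linear => q a x y; case: ifP => _; rewrite !linearP.
Qed.
HB.instance Definition _ m := GRing.isLinear.Build k (natnat C m.+1) (natnat C m)
  *:%R (@drow m) (@drow_is_linear m).

Lemma opI_coef m (x : natl C m) q : (q <= m)%N ->
  opI x q = if odd (m - q) then raised (fun q y => @ops' k C q (opN y)) x q else x q.
Proof.
move=> qm; have Pq : gindex m xpredT q by rewrite /gindex qm.
(* In top degree s' N y would sit at the exponent -1 of u, where umon is 0. *)
have -> : opI x = gext (fun q (y : C q) => umon m xpredT y) x +
    gext (fun q (y : C q) => umon m xpredT (@ops' k C q (opN y))) x.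
  rewrite -gextD; apply: eq_bigr => i _; case: eqP => // im.
  by rewrite [X in _ + X]umon_out ?addr0 // /gindex im ltnn.
rewrite gcoefD (@gext_coef _ _ _ _ _ _ _ _ _ q) => [|i a y z|i y iq]; last first.
- by rewrite umon_coef_neq.
- by rewrite linearP.
rewrite umon_coef //.
rewrite (gext_raised (fun q => (@ops' k C q) \o (@opN k C q))) //.
case: ifPn => mq.
  by rewrite [x q]Defs.coef0 ?add0r // /gindex qm /= /even_weight mq.
case: q qm {Pq} mq => [|q] qm mq; rewrite /= ?addr0 //.
rewrite [x q]Defs.coef0 ?linear0 ?addr0 //.
by rewrite /gindex /even_weight -(subSS q m) subSn //= (negbTE mq) andbF.
Qed.

Lemma opJ_coef m (x : natnat C m) q : gindex m even_weight q ->
  opJ x q = x q + raised (fun q y => one_minus (@tau k C q.+1) (@ops' k C q y)) x q.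
Proof.
move=> Pq; have [qm mq] : (q <= m)%N /\ ~~ odd (m - q) by apply/andP.
rewrite /opJ.
pose F0 q (y : C q) : natl C m := if ~~ odd (m - q) then umon m even_weight y else 0.
pose F1 q (y : C q) : natl C m := if ~~ odd (m - q) then 0 else
  umon m even_weight (one_minus (@tau k C q.+1) (ops' y)).
have -> : gext (fun q y => if ~~ odd (m - q) then umon m even_weight y
  else umon m even_weight (one_minus (@tau k C q.+1) (ops' y))) x = gext F0 x + gext F1 x.
  by rewrite -gextD; apply: eq_bigr => i _; rewrite /F0 /F1; case: ifP; rewrite ?addr0 ?add0r.
rewrite gcoefD (@gext_coef _ _ _ _ _ _ _ _ _ q) => [|i a y z|i y iq]; last first.
- by rewrite /F0; case: ifP => _; rewrite ?gcoef0 ?umon_coef_neq.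
- by rewrite /F0; case: ifP => _; rewrite ?linearP ?scaler0 ?addr0.
rewrite /F0 mq umon_coef //; congr (_ + _).
have -> : gext F1 x = gext (fun q y => umon m even_weight
    (one_minus (@tau k C q.+1) (ops' y))) x.
  apply: eq_bigr => i _; rewrite /F1; case: ifP => // mi.
  (* For m - i even, C_(i+1) is not a summand of natl, so umon is 0 on it. *)
  have [im|mi'] := leqP m i; first by rewrite umon_out // /gindex ltnNge im.
  rewrite -subnSK //= negbK in mi.
  by rewrite umon_out // /gindex /even_weight mi andbF.
by rewrite (gext_raised (fun q => one_minus (@tau k C q.+1) \o @ops' k C q)).
Qed.

Lemma bBu_coef m (x : natl C m.+1) q : gindex m even_weight q ->
  bBu x q = opb (x q.+1) + raised (@opB k C) x q.
Proof.
move=> Pq; have -> : bBu x = gext (fun q (y : C q) =>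
  lowered (W := fun=> natl C m) (@opb k C) (@umon k C m even_weight) y) x +
  gext (fun q (y : C q) => umon m even_weight (@opB k C q y)) x.
  rewrite -gextD; apply: eq_bigr => i _; case: ifP => // im.
  by rewrite [X in _ = _ + X]umon_out // /gindex ltnNge ltnW // ltnNge im.
rewrite gcoefD (gext_raised (fun q => @opB k C q : {linear C q -> C q.+1})) //.
congr (_ + _).
rewrite (@gext_coef _ _ _ _ _ _ _ _ _ q.+1) => [|i a y z|[|i] y iq].
- by rewrite /= umon_coef.
- by rewrite lowered_linear //; move=> *; exact: linearP.
- by rewrite /= gcoef0.
- by rewrite /= umon_coef_neq.
Qed.

Section Rational.
Variable iota : {rmorphism rat -> k}.

Lemma phi_coef m (x : natnat C m) q :
  phi iota x q = if odd (m - q) then - hat iota (x q) else - hatD iota (x q).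
Proof.
rewrite /phi (@gext_coef _ _ _ _ _ _ _ _ _ q) => [|i a y z|i y iq].
- have [qm|mq] := leqP q m.
    have Pq : gindex m.+1 xpredT q by rewrite /gindex leqW.
    by case: odd; rewrite gcoefN umon_coef.
  by rewrite (coef_gt x mq) !linear0 ?oppr0; case: odd; rewrite gcoef0.
- by case: ifP => _; rewrite !linearP.
- by case: ifP => _; rewrite gcoefN umon_coef_neq ?oppr0.
Qed.

(** phi has positive exponents of u only. *)
Lemma phi_top m (x : natnat C m) : phi iota x m.+1 = 0.
Proof. by rewrite phi_coef (coef_gt x) ?leqnn // !linear0 ?oppr0; case: odd. Qed.

Lemma nu_top m (x : C m) : nu iota x m = hatN iota x.
Proof. by rewrite /nu umon_coef // /gindex leqnn. Qed.

Lemma nu_below m (x : C m) q : (q < m)%N -> nu iota x q = 0.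
Proof. by move=> qm; rewrite /nu umon_coef_neq // gtn_eqF. Qed.

End Rational.
End CoefficientFormulas.

(** * The cyclic bicomplex *)

Lemma geometric_sum_fix (k : nzRingType) (V : lmodType k) (P : {linear V -> V}) n y :
  iter n.+1 P y = 0 ->
  \sum_(j < n.+1) iter j P y = y + P (\sum_(j < n.+1) iter j P y).
Proof.
move=> Py0; rewrite linear_sum [in RHS]big_ord_recr /=.
rewrite -[P (iter n P y)]/(iter n.+1 P y).
by rewrite Py0 addr0 big_ord_recl.
Qed.

Section Bicomplex.
Variables (k : nzRingType) (C : hUnital k).

Lemma hat_natmul (iota : {rmorphism rat -> k}) m (x : C m) :
  hat iota x *+ m.+1 = x.
Proof.
rewrite /hat scalerMnl -mulr_natr -(rmorph_nat iota) -rmorphM.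
rewrite mulVf ?rmorph1 ?scale1r //.
by rewrite Num.Theory.pnatr_eq0.
Qed.

Lemma hat_tau (iota : {rmorphism rat -> k}) m (x : C m) :
  hat iota (tau x) = tau (hat iota x).
Proof. by rewrite /hat /tau linearZ /= !scalerA (commr_sign _ m). Qed.

(** Summation by parts: the weights m - j drop by one at each step, so (1 - tau) D
    telescopes to (m + 1) - N. *)
Lemma one_minus_tau_hatD (iota : {rmorphism rat -> k}) m (x : C m) :
  one_minus (@tau k C m) (hatD iota x) + hatN iota x = x.
Proof.
pose f j := iter j (@tau k C m) (hat iota x).
rewrite -[RHS](hat_natmul iota) -[RHS]subr0.
rewrite /one_minus /hatN /opN /hatD linear_sum -sumrB -big_split /=.
rewrite -(big_mkord xpredT (fun j => f j *+ (m - j) - tau (f j *+ (m - j)) + f j)).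
rewrite (telescope_sumr_eq (fun j => - (f j *+ (m.+1 - j)))) // => [|j /andP[_ jm]].
  by rewrite subnn subn0 mulr0n opprK addrC.
rewrite opprK subSS linearMn.
by rewrite addrAC -mulrSr -subSn //= addrC.
Qed.

Lemma hatD_one_minus_tau (iota : {rmorphism rat -> k}) m (x : C m) :
  hatD iota (one_minus (@tau k C m) x) + hatN iota x = x.
Proof.
rewrite -[RHS](one_minus_tau_hatD iota); congr (_ + _).
rewrite /one_minus linearB; congr (_ - _); rewrite /hatD linear_sum.
by apply: eq_bigr => j _; rewrite /= hat_tau linearMn -iterSr.
Qed.

Lemma delta_delta m (x : natnat C m.+2) : delta (delta x) = 0.
Proof.
apply: gsumP => q _; rewrite gcoef0 !delta_coef subSS.
by case: odd; rewrite /= ?linearN /= ?opb_opb ?opb'_opb' ?oppr0.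
Qed.

Lemma delta_drow m (x : natnat C m.+2) : delta (drow x) = - drow (delta x).
Proof.
apply: gsumP => q /andP[qm _].
rewrite gcoefN delta_coef !drow_coef // !delta_coef subSS parity_succ //.
case: odd => /=; first by rewrite opN_opb.
by rewrite linearN /= opprK opb_one_minus_tau.
Qed.

(** Both N (1 - tau) and (1 - tau) N equal 1 - T. *)
Lemma drow_drow m (x : natnat C m.+2) :
  (forall q (y : C q), opT y = y) -> drow (drow x) = 0.
Proof.
move=> T1; apply: gsumP => q /andP[qm _].
rewrite gcoef0 drow_coef // drow_coef ?leqW // parity_succ //.
by case: odd; rewrite /= ?opN_one_minus_tau ?one_minus_tau_opN /one_minus /= T1 subrr.
Qed.

(** The total differential of the cyclic bicomplex. *)
Definition dnatnat m (x : natnat C m.+1) : natnat C m := delta x + drow x.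

(** At odd exponents this is N - b' s' N = s' b' N = s' N b. *)
Lemma dnatnat_opI m (x : natl C m.+1) : dnatnat (opI x) = opI (bBu x).
Proof.
apply: gsumP => q /andP[qm _].
rewrite gcoefD delta_coef drow_coef //.
have qm1 := leqW qm; rewrite !opI_coef // subSS parity_succ // {qm1}.
have [mq|mq] := boolP (odd (m - q)); last first.
  by rewrite bBu_coef /= ?/gindex ?qm //; case: q qm mq => [|q] qm mq; rewrite //= linear0.
rewrite /=; case: q qm mq => [|q] qm mq.
  by rewrite /= -[X in _ + X](ops'_htpy (opN (x 0%N))) /= addr0 addNr.
rewrite /= bBu_coef; last first.
  by rewrite /gindex (ltnW qm) /even_weight -subnSK //= mq.
rewrite !linearD /=.
have -> : ops' (opN (raised (@opB k C) x q)) = 0.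
  by case: q {qm mq} => [|q] /=; rewrite ?linear0 ?ops'_opN_opB.
by rewrite addr0 opN_opb -[X in _ + X](ops'_htpy (opN (x q.+1))) addKr.
Qed.

(** On x u^(2p+1) this is (1 - tau) (1 - s' b') = (1 - tau) b' s'
    = b (1 - tau) s'. *)
Lemma opJ_dnatnat m (x : natnat C m.+1) : opJ (dnatnat x) = bBu (opJ x).
Proof.
apply: gsumP => q Pq; have [qm mq] : (q <= m)%N /\ odd (m - q) = false.
  by case/andP: Pq => qm /negbTE mq.
have Pq1 : gindex m.+1 even_weight q.+1 by [].
rewrite opJ_coef // bBu_coef // (opJ_coef _ Pq1) /= linearD /=.
rewrite gcoefD delta_coef drow_coef // mq -[LHS]addrA -[RHS]addrA; congr (_ + _).
rewrite -opb_one_minus_tau_ops' -[LHS]addrA; congr (_ + _).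
case: q qm mq {Pq Pq1} => [|q] qm mq /=; first by rewrite !addr0.
have mq1 : odd (m - q) = true by rewrite -subnSK //= mq.
have Pq1 : gindex m.+1 even_weight q.
  by rewrite /gindex /even_weight parity_succ ?(ltnW qm) // mq1 leqW // ltnW.
rewrite gcoefD delta_coef drow_coef 1?ltnW // mq1 /= (opJ_coef _ Pq1) !linearD /=.
rewrite linearN /= linearN /= addrA subrr add0r.
rewrite [X in _ = _ + X](_ : _ = 0) ?addr0 //.
case: q {qm mq mq1 Pq1} => [|q] /=; rewrite ?linear0 //.
exact: opB_one_minus_tau_ops'.
Qed.

(** The correction terms of I and J compose to (1 - tau) s' s' N = 0. *)
Lemma opJ_opI m (x : natl C m) : opJ (opI x) = x.
Proof.
apply: gsumP => q Pq; have [qm mq] : (q <= m)%N /\ odd (m - q) = false.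
  by case/andP: Pq => qm /negbTE mq.
rewrite opJ_coef // opI_coef // mq; case: q qm mq {Pq} => [|q] qm mq; rewrite ?addr0 //=.
rewrite opI_coef 1?ltnW // -subnSK //= mq /=.
case: q {qm mq} => [|q] /=; rewrite ?ops'_ops' !linear0 addr0 //.
Qed.

Lemma opI_top m (x : natl C m) : opI x m = x m.
Proof. by rewrite opI_coef // subnn. Qed.

Lemma opJ_top m (x : natnat C m) : pilam (opJ x m) = pilam (x m).
Proof.
rewrite opJ_coef; last by rewrite /gindex leqnn subnn.
rewrite linearD /= [X in _ + X](_ : _ = 0) ?addr0 //; apply/cpi_eq0.
by case: m x => [|m] x /=; [exists 0; rewrite linear0 | eexists].
Qed.

(** * Homological perturbation *)

Section Perturbation.
Variable iota : {rmorphism rat -> k}.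

Local Notation through_below d g :=
  (@lowered k (fun n => natnat C n) (fun n => natnat C n) (fun n => natnat C n) d g _).

(** The rows are contracted by phi onto their u^0-part: at even positive exponents
    this is (1 - tau) D^ + N^ = 1, at exponent 0 the term N^ is missing and
    reappears as nu, at odd exponents it is N^ + D^ (1 - tau) = 1. *)
Lemma drow_phi m (x : natnat C m) :
  drow (phi iota x) + through_below (@drow k C) (@phi k C iota) x = nu iota (x m) - x.
Proof.
apply: gsumP => q /andP[qm _].
rewrite !gcoefD gcoefN drow_coef // phi_coef.
move: qm; rewrite leq_eqVlt => /predU1P[qm|qm].
  subst q; rewrite subnn /= nu_top linearN /=.
  have -> : through_below (@drow k C) (@phi k C iota) x m = 0.
    by case: m x => [|m] x /=; rewrite ?gcoef0 ?phi_top.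
  rewrite addr0 -[X in _ = _ - X](one_minus_tau_hatD iota).
  by move: (one_minus _ _) => u; rewrite opprD addrCA subrr addr0.
rewrite nu_below // add0r; case: m x qm => // m x qm /=.
rewrite phi_coef drow_coef // parity_succ //.
case: odd; rewrite /= linearN /= -[in LHS]opprD; congr (- _).
  rewrite -[RHS](one_minus_tau_hatD iota); congr (_ + _).
  by rewrite /hatN /hat linearZ.
by rewrite -[RHS](hatD_one_minus_tau iota) addrC.
Qed.

Lemma phinatnat_fix m (x : natnat C m) :
  phinatnat iota x = phi iota x + phidelta iota (phinatnat iota x).
Proof. by apply: geometric_sum_fix; exact: phidelta_nilpotent. Qed.

Lemma nu0natnat_fix m (x : C m) :
  nu0natnat iota x = nu iota x + phidelta iota (nu0natnat iota x).
Proof. by apply: geometric_sum_fix; exact: phidelta_nilpotent. Qed.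

Lemma phidelta_top m (x : natnat C m) : phidelta iota x m = 0.
Proof. by case: m x => [|m] x; rewrite /phidelta /= ?gcoef0 ?phi_top. Qed.

Lemma phinatnat_top m (x : natnat C m) : phinatnat iota x m.+1 = 0.
Proof. by rewrite phinatnat_fix gcoefD phi_top phidelta_top addr0. Qed.

Lemma nu0natnat_top m (x : C m) : nu0natnat iota x m = hatN iota x.
Proof. by rewrite nu0natnat_fix gcoefD nu_top phidelta_top addr0. Qed.

(** As phi delta is nilpotent, 1 - phi delta is injective. *)
Lemma phidelta_eq0 m (x : natnat C m) : x = phidelta iota x -> x = 0.
Proof.
move=> xP; rewrite -(phidelta_nilpotent iota x).
by elim: m.+1 => //= n <-.
Qed.

(** delta anticommutes with the row differential r and delta^2 = 0, so phi r delta
    may be traded for - phi delta d. *)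
Lemma lowered_drow_phi_delta m (x : natnat C m.+1) :
  through_below (@drow k C) (@phi k C iota) (delta x) = - phidelta iota (dnatnat x).
Proof.
case: m x => [|m] x /=; first by rewrite oppr0.
rewrite /phidelta /= /dnatnat linearD /= delta_delta add0r delta_drow.
by rewrite !linearN opprK.
Qed.

(** With r the row differential, r phi (delta S) is rewritten by [drow_phi]; its nu-term is absent because S has
    no u^0-coefficient. *)
Lemma dnatnat_phinatnat m (x : natnat C m) :
  dnatnat (phinatnat iota x) =
  drow (phi iota x) + phidelta iota (dnatnat (phinatnat iota x)).
Proof.
set S := phinatnat iota x.
rewrite -[phidelta _ _]opprK -lowered_drow_phi_delta.
have dS0 : delta S m = 0 by rewrite delta_coef phinatnat_top !linear0 if_same.
rewrite (canRL (addKr _) (drow_phi (delta S))) dS0 linear0 sub0r opprD !opprK.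
by rewrite {1}/dnatnat [delta S + _]addrC {1}/S {1}phinatnat_fix linearD -addrA.
Qed.

Lemma phinatnat_dnatnat m (x : natnat C m) :
  through_below dnatnat (@phinatnat k C iota) x =
  through_below (@drow k C) (@phi k C iota) x + phidelta iota x +
  phidelta iota (through_below dnatnat (@phinatnat k C iota) x).
Proof.
case: m x => [|m] x /=; first by rewrite !addr0.
rewrite {1}phinatnat_fix; congr (_ + _).
by rewrite /dnatnat linearD addrC.
Qed.

(** By the two preceding lemmas, the fixed-point equation of nu_0 and [drow_phi],
    the difference E of the two sides satisfies E = phi delta E. *)
Lemma phinatnat_homotopy m (x : natnat C m) :
  nu0natnat iota (x m) = x + dnatnat (phinatnat iota x) +
    through_below dnatnat (@phinatnat k C iota) x.
Proof.
apply/esym/eqP; rewrite -subr_eq0; apply/eqP/phidelta_eq0.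
rewrite {1}dnatnat_phinatnat {1}phinatnat_dnatnat {1}nu0natnat_fix.
have -> : nu iota (x m) =
    drow (phi iota x) + through_below (@drow k C) (@phi k C iota) x + x.
  by rewrite drow_phi subrK.
move: (dnatnat _) (through_below dnatnat _ _) (nu0natnat _ _) => DS SD n0.
rewrite !linearD linearN /=.
move: (phidelta _ x) (phidelta _ DS) (phidelta _ SD) (phidelta _ n0) => p P1 P2 P3.
move: (drow _) (lowered _ _ _) => v l.
rewrite !addrA; congr (_ - _); apply/eqP; rewrite !subr_eq; apply/eqP.
by rewrite [LHS](ACl (5*3*6*1*4*2)).
Qed.

End Perturbation.
End Bicomplex.

(** * Transport to C^natural and descent to C_T *)

Section Descent.
Variables (k : nzRingType) (C : hUnital k).

Lemma natl_homotopy (iota : {rmorphism rat -> k}) m (x : natl C m) :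
  nu0nat iota (x m) = x + bBu (phinat iota x) +
    @lowered k (fun n => natl C n) (fun n => natl C n) (fun n => natl C n)
      (@bBu k C) (@phinat k C iota) m x.
Proof.
rewrite /nu0nat -opI_top phinatnat_homotopy 2!(linearD (@opJ k C m)) /=.
rewrite opJ_opI opJ_dnatnat.
congr (_ + _); case: m x => [|m] x /=; first by rewrite linear0.
by rewrite dnatnat_opI.
Qed.

(** (b + B u^-1)^2 = J d^2 I, and d^2 is the square of the row differential. *)
Lemma bBu_bBu m (x : natl C m.+2) :
  (forall q (y : C q), opT y = y) -> bBu (bBu x) = 0.
Proof.
move=> T1; rewrite -[LHS]opJ_opI -!dnatnat_opI /dnatnat.
rewrite [delta (_ + _)]linearD [drow (_ + _)]linearD /= delta_delta drow_drow //.
by rewrite add0r addr0 delta_drow addNr linear0.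
Qed.

Lemma opb_tpara m (x : C m.+1) : @opb k (tpara C) m (piT x) = piT (opb x).
Proof.
rewrite /opb linear_sum; apply: eq_bigr => j _; rewrite linearZ.
by congr (_ *: _); exact: (tmapE (fun x => face_opT x j)).
Qed.

Lemma tau_tpara m (x : C m) : @tau k (tpara C) m (piT x) = piT (tau x).
Proof.
by rewrite /tau linearZ; congr (_ *: _); exact: (tmapE (@cyc_opT k C m)).
Qed.

Lemma opN_tpara m (x : C m) : @opN k (tpara C) m (piT x) = piT (opN x).
Proof.
rewrite /opN linear_sum; apply: eq_bigr => j _.
by elim: (j : nat) => // n IHn; rewrite !iterS IHn tau_tpara.
Qed.

Lemma ops'_hquotT m (x : C m) : @ops' k (hquotT C) m (piT x) = piT (ops' x).
Proof.
have tsdegE n (y : C n) : sdeg (hquotT C) n (piT y) = piT (sdeg C n y).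
  exact: (tmapE (@sdeg_opT k C n)).
by rewrite /ops' tsdegE opb'_tpara tsdegE.
Qed.

Lemma opB_hquotT m (x : C m) : @opB k (hquotT C) m (piT x) = piT (opB x).
Proof.
rewrite /opB opN_tpara ops'_hquotT /one_minus linearB /=.
by congr (_ - _); exact: tau_tpara.
Qed.

Lemma piTnat_bBu m (x : natl C m.+1) :
  piTnat (bBu x) = @bBu k (hquotT C) m (piTnat x).
Proof.
apply: gsumP => q Pq; rewrite (gmapE (D := hquotT C)) !bBu_coef //.
rewrite (gmapE (D := hquotT C)) opb_tpara linearD; congr (_ + _).
case: q {Pq} => [|q] /=; first by rewrite linear0.
by rewrite (gmapE (D := hquotT C)) opB_hquotT.
Qed.

(** B contributes to the u^0-coefficient an element of ran (1 - tau). *)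
Lemma pinat_bBu m (x : natl C m.+1) : pinat (bBu x) = pilam (opb (x m.+1)).
Proof.
rewrite /pinat bBu_coef; last by rewrite /gindex leqnn subnn.
rewrite linearD [X in _ + X](_ : _ = 0) ?addr0 //; apply/cpi_eq0.
by case: m x => [|m] x /=; [exists 0; rewrite linear0 | eexists].
Qed.

End Descent.

Theorem proposition10p2 (k : nzRingType) (iota : {rmorphism rat -> k})
    (C : hUnital k) :
  [/\ forall m (x : lam C m), barpi C m (barnu C iota m x) = x,
      forall m (x : natlT C m),
        barnu C iota m (barpi C m x) =
        x + dnatlT C m (barphi C iota m x) + lowered (dnatlT C) (barphi C iota) x,
      forall m (x : natlT C m), barpi C m.+1 (barphi C iota m x) = 0 &
      deformation_retract (dnatlT C) (blam C) (barpi C) (barnu C iota)].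
Proof.
have pi_nu m (x : lam C m) : barpi C m (barnu C iota m x) = x.
  have [y <-] := cpi_surj x.
  rewrite -[cpi _ y]/(pilam y) barnuE barpiE /pinat opJ_top nu0natnat_top.
  apply/esym/cpi_eq; exists (hatD iota y).
  by rewrite -[X in X - _](one_minus_tau_hatD iota) addrK.
have nu_pi m (x : natlT C m) : barnu C iota m (barpi C m x) =
    x + dnatlT C m (barphi C iota m x) + lowered (dnatlT C) (barphi C iota) x.
  have [y <-] := piTnat_surj x.
  rewrite barpiE barnuE barphiE natl_homotopy !linearD /= piTnat_bBu.
  congr (_ + _); case: m y {x} => [|m] y /=; first by rewrite linear0.
  by rewrite -barphiE piTnat_bBu.
have dT2 : is_complex (dnatlT C) by move=> m x; exact/bBu_bBu/opT_tpara.
(* This is h d^2. *)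
have low0 m (x : natlT C m.+1) :
    lowered (dnatlT C) (barphi C iota) (dnatlT C m x) = 0.
  case: m x => // m x.
  by rewrite -[LHS]/(barphi C iota m (dnatlT C m (dnatlT C m.+1 x))) dT2 linear0.
have pi_d : chain_map (dnatlT C) (blam C) (barpi C).
  move=> m x; have [y <-] := piTnat_surj x.
  by rewrite -[dnatlT _ _ _]piTnat_bBu !barpiE pinat_bBu blamE.
split=> // [m x|].
  have [y <-] := piTnat_surj x; rewrite barphiE barpiE /pinat opJ_top.
  by rewrite phinatnat_top linear0.
split=> //.
- split=> // m x; have [y <-] := cpi_surj x.
  by rewrite -[cpi _ y]/(pilam y) !blamE opb_opb linear0.
- (* With y = nu x, both nu b x and d nu x are equal to d y + d h d y. *)
  move=> m x; rewrite -[in LHS](pi_nu _ x) -pi_d nu_pi low0 addr0.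
  by rewrite -[in RHS](pi_nu _ x) nu_pi !linearD /= dT2 addr0.
- exists (barphi C iota) => m x; rewrite nu_pi.
  by rewrite -[x + _ + _]addrA [x + _]addrC addrK.
Qed.
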